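(* Let $H$ be an infinite-dimensional complex Hilbert space and let $k$ be a positive integer. Let $f:{\mathcal G}_{k}(H)\to{\mathcal G}_{k}(H)$ be an injective map and let $H'$ be the smallest closed subspace of $H$ containing all elements $f(X)$, $X\in{\mathcal G}_{k}(H)$, of the image of $f$. Suppose that $f$ satisfies the following condition: for any orthogonal $X,Y\in{\mathcal G}_{k}(H)$ there is a family $\{Z_{j}\}_{j\in J}$ of mutually orthogonal elements of ${\mathcal G}_{k}(H)$ such that each $Z_{j}$ is orthogonal to $X+Y$ and $H'$ is the orthogonal sum of $f(X)$, $f(Y)$ and all $f(Z_{j})$, $j\in J$. Then $f$ is induced by a linear or conjugate-linear isometry, i.e. there is a linear or conjugate-linear isometry $L:H\to H$ such that $f(X)=L(X)$ for every $X\in{\mathcal G}_{k}(H)$.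
   Context: ${\mathcal G}_{k}(H)$ denotes the set of all $k$-dimensional (complex linear) subspaces of $H$. Two subspaces are orthogonal if every vector of one is orthogonal to every vector of the other. A closed subspace $H'$ is the orthogonal sum of a family of closed subspaces if the members of the family are mutually orthogonal and $H'$ is the closed linear span of their union (Hilbert space direct sum). Isometries are not assumed to be surjective. *)

(* Defs.v *)
From mathcomp Require Import all_boot all_order all_algebra sesquilinear.
From mathcomp Require Import all_classical all_reals all_analysis.
From mathcomp Require Import complex.

Set Implicit Arguments.
Unset Strict Implicit.
Unset Printing Implicit Defensive.

Import Order.TTheory GRing.Theory Num.Theory Num.Def.
Import numFieldNormedType.Exports.

Local Open Scope classical_set_scope.
Local Open Scope ring_scope.

Definition linear_subspace (K : numFieldType) (V : lmodType K) (A : set V) :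
  Prop := GRing.submod_closed (mem A).

Definition lincomb (K : numFieldType) (V : lmodType K) (n : nat)
    (e : 'I_n -> V) (c : 'I_n -> K) : V :=
  \sum_(i < n) c i *: e i.

Definition lin_indep (K : numFieldType) (V : lmodType K) (n : nat)
    (e : 'I_n -> V) : Prop :=
  forall c : 'I_n -> K, lincomb e c = 0 -> forall i, c i = 0.

Definition is_basis (K : numFieldType) (V : lmodType K) (n : nat)
    (e : 'I_n -> V) (A : set V) : Prop :=
  lin_indep e /\ A = range (lincomb e).

Definition has_dim (K : numFieldType) (V : lmodType K) (n : nat) (A : set V) :
  Prop := exists e : 'I_n -> V, is_basis e A.

Definition infinite_dimensional (K : numFieldType) (V : lmodType K) : Prop :=
  ~ exists n : nat, has_dim n [set: V].

(* As a [set], it coerces to the type of its elements [X], and the underlying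
   subspace of [V] is then [val X]. *)
Definition grassmannian (K : numFieldType) (V : lmodType K) (k : nat) :
  set (set V) := [set A | linear_subspace A /\ has_dim k A].
Arguments grassmannian {K} V k.

Definition sum_subspace (V : zmodType) (A B : set V) : set V :=
  [set a + b | a in A & b in B].

Definition closed_subspace (K : numFieldType) (V : normedModType K)
    (A : set V) : Prop :=
  linear_subspace A /\ closed A.

Definition closed_span (K : numFieldType) (V : normedModType K) (A : set V) :
  set V := smallest (@closed_subspace K V) A.

(* [ip] is the inner product that defines the norm of [H]; together with the
   completeness of [H], this makes [H] a complex Hilbert space.  Inner products
   are linear in the first argument and conjugate-linear in the second, and
   norms are elements of R[i] that happen to be real. *)
Definition norm_induced_by (R : realType) (H : normedModType R[i])
    (ip : {dot H for conjC}) : Prop :=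
  forall x : H, `|x| ^+ 2 = ip x x.

Definition subspace_ortho (R : realType) (H : lmodType R[i]) (ip : {dot H for conjC})
    (A B : set H) : Prop :=
  forall a b : H, A a -> B b -> ip a b = 0.

Definition mutually_ortho (R : realType) (H : lmodType R[i])
    (ip : {dot H for conjC}) (J : Type) (F : J -> set H) : Prop :=
  forall i j : J, i <> j -> subspace_ortho ip (F i) (F j).

Definition orthogonal_sum (R : realType) (H : normedModType R[i])
    (ip : {dot H for conjC}) (J : Type) (F : J -> set H) (S : set H) : Prop :=
  [/\ forall j, closed_subspace (F j), mutually_ortho ip F
    & S = closed_span (\bigcup_j F j)].

(* The family consisting of [a], [b] and all the members of [z]. *)
Definition add_two (T J : Type) (a b : T) (z : J -> T) (i : bool + J) : T :=
  match i with
  | inl true => a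
  | inl false => b
  | inr j => z j
  end.

Definition conj_linear (R : realType) (U V : lmodType R[i]) (L : U -> V) :
  Prop := GRing.linear_for (conjC \; *:%R) L.

Definition is_isometry (K : numFieldType) (U V : normedModType K)
    (L : U -> V) : Prop :=
  forall x y : U, `|L x - L y| = `|x - y|.

(* Main.v *)
(* The map f preserves orthogonality, and f(W) lies in f(X) + f(Y) whenever X
   and Y are orthogonal and W lies in X + Y: W is orthogonal to all Z_j, so f(W)
   is orthogonal to all f(Z_j), and these together with f(X) + f(Y) exhaust H'.

   For a vector e, let E(e) be the intersection of all f(X) with e in X.
   Comparing f(e + U), f(e + U') and f(e' + U) for mutually orthogonal e, e', U,
   U' of dimensions 1, 1, k-1, k-1 shows that f(e + U) and f(e + U') share a
   nonzero vector, and that their intersection lies in f(e + V) for every V;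
   hence E(e) <> 0.  If e_1, ..., e_k is an orthogonal basis of X, the E(e_i)
   are nonzero mutually orthogonal subspaces of the k-dimensional f(X), so they
   are lines and f(X) is their sum.

   The induced map on lines is injective, preserves orthogonality and maps the
   lines of a plane into a plane.  As in the fundamental theorem of projective
   geometry it is induced by a semilinear map; orthogonality makes that map
   isometric and its field morphism commute with complex conjugation, so the
   morphism fixes the reals and is the identity or the conjugation. *)

Require Import Defs.
From HB Require Import structures.
From mathcomp Require Import all_boot all_order all_algebra sesquilinear.
From mathcomp Require Import all_classical all_reals all_analysis.
From mathcomp Require Import complex.

Set Implicit Arguments.
Unset Strict Implicit.
Unset Printing Implicit Defensive.

Import Order.TTheory GRing.Theory Num.Theory Num.Def.
Import numFieldNormedType.Exports.

Local Open Scope classical_set_scope.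
Local Open Scope ring_scope.

(** * Spans and orthogonal families *)

Section LinearSpan.
Variables (K : numFieldType) (V : lmodType K).
Implicit Types (A : set V) (s t : seq V).

(** Spans are taken of lists, so that concatenation corresponds to the sum of subspaces and the
    predicates on orthogonal sequences apply. *)
Fixpoint lspan s : set V :=
  if s is x :: s' then [set a *: x + y | a in [set: K] & y in lspan s']
  else [set 0].

Lemma linear_subspaceP A :
  linear_subspace A <->
  A 0 /\ forall a x y, A x -> A y -> A (a *: x + y).
Proof.
split=> -[A0 AD]; split=> //.
- by move: A0; rewrite -topredE /= inE.
- by move=> a x y Ax Ay; have := AD a x y; rewrite -!topredE /= !inE; apply.
- by rewrite -topredE /= inE.
- by move=> a x y; rewrite -!topredE /= !inE; apply: AD.
Qed.

Lemma lspan_cons x s a y : lspan s y -> lspan (x :: s) (a *: x + y).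
Proof. by move=> sy; exists a => //; exists y. Qed.

Lemma linear_lspan s : linear_subspace (lspan s).
Proof.
apply/linear_subspaceP; elim: s => [|z s [s0 sD]] /=.
  by split=> // a x y -> ->; rewrite scaler0 addr0.
split; first by exists 0 => //; exists 0 => //; rewrite scale0r addr0.
move=> a _ _ [b _ [x sx <-]] [c _ [y sy <-]].
exists (a * b + c) => //; exists (a *: x + y); first exact: sD.
by rewrite scalerDl scalerDr scalerA addrACA.
Qed.

Lemma subspace0 A : linear_subspace A -> A 0.
Proof. by case/linear_subspaceP. Qed.

Lemma subspaceD A x y : linear_subspace A -> A x -> A y -> A (x + y).
Proof. by case/linear_subspaceP=> _ AD Ax Ay; rewrite -[x]scale1r; apply: AD. Qed.

Lemma subspaceZ A a x : linear_subspace A -> A x -> A (a *: x).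
Proof.
by case/linear_subspaceP=> A0 AD Ax; rewrite -[_ *: _]addr0; apply: AD.
Qed.

Lemma subspaceB A x y : linear_subspace A -> A x -> A y -> A (x - y).
Proof.
by move=> lA Ax Ay; apply: subspaceD => //; rewrite -scaleN1r; apply: subspaceZ.
Qed.

Lemma mem_lspan s x : x \in s -> lspan s x.
Proof.
elim: s => //= y s IHs; rewrite inE => /predU1P[->|/IHs sx].
  by exists 1 => //; exists 0; rewrite ?addr0 ?scale1r//; apply: subspace0;
    exact: linear_lspan.
by exists 0 => //; exists x => //; rewrite scale0r add0r.
Qed.

Lemma lspan_sub A s :
  linear_subspace A -> (forall x, x \in s -> A x) -> lspan s `<=` A.
Proof.
move=> lA; have [A0 AD] := (linear_subspaceP A).1 lA.
elim: s => [_ _ ->//|x s IHs sA _ [a _ [y sy <-]]].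
apply: AD; first exact/sA/mem_head.
by apply: IHs sy => z sz; apply: sA; rewrite in_cons sz orbT.
Qed.

Lemma lspan_mono s t : {subset s <= t} -> lspan s `<=` lspan t.
Proof.
by move=> st; apply: lspan_sub (linear_lspan t) _ => x /st; apply: mem_lspan.
Qed.

Lemma lspan_shift x p s t : lspan t = lspan s -> lspan s p ->
  lspan (x + p :: t) = lspan (x :: s).
Proof.
(* One inclusion in general form; the reverse one is the same statement with [- p] for [p]. *)
have sub y q s' t' : lspan t' = lspan s' -> lspan s' q ->
    lspan (y + q :: t') `<=` lspan (y :: s').
  move=> ts sq _ [a _ [z tz <-]]; rewrite scalerDr -addrA; apply: lspan_cons.
  have ls := linear_lspan s'; apply: subspaceD => //; last by rewrite -ts.
  exact: subspaceZ.
move=> ts sp; apply/seteqP; split; first exact: sub.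
rewrite -[in X in X `<=` _](addrK p x); apply: sub => //.
by rewrite ts -scaleN1r; apply: subspaceZ => //; apply: linear_lspan.
Qed.

Lemma lspan_cat s t : lspan (s ++ t) = sum_subspace (lspan s) (lspan t).
Proof.
apply/seteqP; split=> [|_ [a sa [b tb <-]]]; last first.
  apply: subspaceD; first exact: linear_lspan.
    by apply: lspan_mono sa => x; rewrite mem_cat => ->.
  by apply: lspan_mono tb => x; rewrite mem_cat orbC => ->.
elim: s => [|x s IHs] y /=; first by exists 0 => //; exists y; rewrite ?add0r.
move=> [a _ [z /IHs[b sb [c tc <-]] <-]]; exists (a *: x + b).
  exact: lspan_cons.
by exists c => //; rewrite addrA.
Qed.

Lemma linear_range_lincomb n (e : 'I_n -> V) :
  linear_subspace (range (lincomb e)).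
Proof.
apply/linear_subspaceP; split=> [|a _ _ [c _ <-] [d _ <-]].
  by exists (fun=> 0) => //; rewrite /lincomb big1// => i; rewrite scale0r.
exists (fun i => a * c i + d i) => //; rewrite /lincomb scaler_sumr -big_split.
by apply: eq_bigr => i _; rewrite scalerDl scalerA.
Qed.

Lemma lspan_codom n (e : 'I_n -> V) : lspan (codom e) = range (lincomb e).
Proof.
apply/seteqP; split=> [|_ [c _ <-]].
  apply: (lspan_sub (linear_range_lincomb e)) => _ /codomP[i ->].
  exists (fun j => (j == i)%:R) => //; rewrite /lincomb (bigD1 i)//= big1 => [|j].
    by rewrite eqxx scale1r addr0.
  by move=> /negPf ->; rewrite scale0r.
have le := linear_lspan (codom e); rewrite /lincomb.
elim/big_ind: _ => [|x y|i _]; first exact: subspace0.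
  exact: subspaceD.
by apply: subspaceZ => //; apply: mem_lspan; apply: codom_f.
Qed.

Lemma lspan_nth s : lspan s = range (lincomb (fun i : 'I_(size s) => s`_i)).
Proof.
rewrite -lspan_codom; congr lspan.
rewrite /codom /image_mem enumT -{1}(mkseq_nth 0 s) /mkseq -val_enum_ord.
by rewrite enumT -map_comp.
Qed.

(* The matrix of the coordinates of [e] in terms of [t] has no left kernel. *)
Lemma lin_indep_leq n (e : 'I_n -> V) t :
  lin_indep e -> (forall i, lspan t (e i)) -> (n <= size t)%N.
Proof.
move=> ie te.
have /choice[M eM] i : exists c, e i = lincomb (fun j : 'I_(size t) => t`_j) c.
  by have := te i; rewrite lspan_nth => -[c _ <-]; exists c.
pose A := \matrix_(i, j) M i j.
suff /eqP <- : row_free A by exact: rank_leq_col.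
apply: inj_row_free => u uA; apply/rowP => i; rewrite [RHS]mxE.
apply: (ie (u 0)); rewrite /lincomb.
under eq_bigr do rewrite eM scaler_sumr.
rewrite exchange_big big1//= => j _.
under eq_bigr do rewrite scalerA.
rewrite -scaler_suml; move/rowP: uA => /(_ j); rewrite !mxE.
by under eq_bigr do rewrite mxE; move=> ->; rewrite scale0r.
Qed.
End LinearSpan.

(** * Orthogonal projections, Gram-Schmidt and dimension *)

Section Orthogonal.
Variables (C : numClosedFieldType) (H : lmodType C).
Variable ip : {dot H for conjC}.
Implicit Types (A : set H) (s t : seq H).

Lemma dotZl a x y : ip (a *: x) y = a * ip x y.
Proof. exact: linearZl_LR. Qed.

Lemma dotZr a x y : ip x (a *: y) = a^* * ip x y.
Proof. exact: linearZr_LR. Qed.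

Lemma dotDl x y z : ip (x + y) z = ip x z + ip y z.
Proof. exact: linearDl. Qed.

Lemma dotBl x y z : ip (x - y) z = ip x z - ip y z.
Proof. exact: linearBl. Qed.

Lemma dotDr x y z : ip z (x + y) = ip z x + ip z y.
Proof. exact: linearDr. Qed.

Lemma dotBr x y z : ip z (x - y) = ip z x - ip z y.
Proof. exact: linearBr. Qed.

Lemma dotC x y : ip x y = (ip y x)^*.
Proof. by rewrite hermC mul1r. Qed.

Lemma dot0C x y : ip x y = 0 -> ip y x = 0.
Proof. by move=> xy; rewrite dotC xy rmorph0. Qed.

Lemma dot_self0 x : ip x x = 0 -> x = 0.
Proof. by move=> /eqP; rewrite dnorm_eq0 => /eqP. Qed.

Lemma dot_normDd x y : ip x y = 0 -> ip (x + y) (x + y) = ip x x + ip y y.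
Proof. exact: hnormDd. Qed.

Lemma dot_normalize x (c := sqrtC (ip x x)) :
  x != 0 -> ip (c^-1 *: x) (c^-1 *: x) = 1.
Proof.
move=> x0; have c0 : c != 0 by rewrite sqrtC_eq0 dnorm_eq0.
have cc : c * c^* = ip x x by rewrite -normCK ger0_norm ?sqrtC_ge0// sqrtCK.
by rewrite dotZl dotZr -cc fmorphV [X in _ * X]mulrCA mulVf ?conjC_eq0// mulr1 mulVf.
Qed.

(** Pythagoras for the splitting of [x] into its component along [y] and a remainder, whose square
    norm is discarded. *)
Lemma cauchy_schwarz x y : `|ip x y| ^+ 2 <= ip x x * ip y y.
Proof.
have [->|y0] := eqVneq y 0.
  have ip0 z : ip z 0 = 0 by rewrite linear0r.
  by rewrite !ip0 mulr0 normr0 expr0n.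
set a := ip x y / ip y y; have yy : 0 < ip y y by rewrite dnorm_gt0.
have axy : ip (a *: y) (x - a *: y) = 0.
  by apply: dot0C; rewrite dotZr dotBl dotZl divfK ?gt_eqF// subrr mulr0.
have -> : ip x x = ip (a *: y + (x - a *: y)) (a *: y + (x - a *: y)).
  by rewrite addrC subrK.
rewrite dot_normDd// -ler_pdivrMr// -[leLHS]addr0 lerD ?dnorm_ge0//.
rewrite dnormZ normf_div (gtr0_norm yy) expr_div_n.
by rewrite (expr2 (ip y y)) invfM !mulrA divfK// gt_eqF.
Qed.

Lemma orthP s t :
  reflect {in s & t, forall x y, ip x y = 0} (orthogonal ip s t).
Proof.
apply: (iffP allP) => [st x y sx ty|st x sx]; last first.
  by apply/allP => y ty /=; rewrite st.
by have /allP/(_ y ty)/eqP := st x sx.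
Qed.

Lemma orthC s t : orthogonal ip s t = orthogonal ip t s.
Proof. by apply/orthP/orthP => st x y sx ty; apply: dot0C; apply: st. Qed.

Lemma po_cons x s : pairwise_orthogonal ip (x :: s) =
  [&& x != 0, orthogonal ip [:: x] s & pairwise_orthogonal ip s].
Proof.
rewrite -cat1s pairwise_orthogonal_cat; congr andb; last by rewrite andbC.
by rewrite /pairwise_orthogonal /= !andbT inE eq_sym.
Qed.

Lemma po_cat s t : pairwise_orthogonal ip (s ++ t) =
  [&& pairwise_orthogonal ip s, pairwise_orthogonal ip t & orthogonal ip s t].
Proof. exact: pairwise_orthogonal_cat. Qed.

Lemma orth_catl s s' t :
  orthogonal ip (s ++ s') t = orthogonal ip s t && orthogonal ip s' t.
Proof. by rewrite /orthogonal /ortho_rec all_cat. Qed.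

Lemma orth_catr s t t' :
  orthogonal ip s (t ++ t') = orthogonal ip s t && orthogonal ip s t'.
Proof. by rewrite orthC orth_catl !(orthC s). Qed.

Lemma linear_orth y : linear_subspace [set x | ip x y = 0].
Proof.
apply/linear_subspaceP; split=> /= [|a x z xy zy]; first exact: linear0l.
by rewrite dotDl dotZl xy zy mulr0 addr0.
Qed.

Lemma orth_lspanr x t : (forall y, y \in t -> ip x y = 0) ->
  forall y, lspan t y -> ip x y = 0.
Proof.
move=> xt y ty; apply: dot0C.
by apply: (lspan_sub (linear_orth x)) ty => z /xt /dot0C.
Qed.

Lemma orth_lspan s t x y : orthogonal ip s t ->
  lspan s x -> lspan t y -> ip x y = 0.
Proof.
move=> /orthP st sx; apply: orth_lspanr => {}y ty.
by apply: (lspan_sub (linear_orth y)) sx => z sz; apply: st.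
Qed.

(** The orthogonal projection onto [lspan s] when [s] is pairwise orthogonal. *)
Definition orth_proj s v := \sum_(e <- s) (ip v e / ip e e) *: e.

Lemma orth_proj_lspan s v : lspan s (orth_proj s v).
Proof.
rewrite /orth_proj big_seq; have ls := linear_lspan s.
elim/big_ind: _ => [|x y|e se]; first exact: subspace0.
  exact: subspaceD.
by apply: subspaceZ => //; apply: mem_lspan.
Qed.

Lemma orth_proj_orth s v x :
  pairwise_orthogonal ip s -> lspan s x -> ip (v - orth_proj s v) x = 0.
Proof.
move=> os; apply: orth_lspanr => {}x.
elim: s os => //= y s IHs.
rewrite po_cons => /and3P[y0 /orthP ys os]; rewrite /orth_proj big_cons inE.
move=> /predU1P[->|sx].
  rewrite dotBl dotDl dotZl divfK ?dnorm_eq0//.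
  rewrite [X in _ - (_ + X)](_ : _ = 0) ?addr0 ?subrr//.
  apply: dot0C; apply: orth_lspanr (orth_proj_lspan s v) => z sz.
  by apply: ys; rewrite ?inE.
rewrite opprD addrCA addrC dotBl dotZl (ys y x) ?inE//.
by rewrite mulr0 subr0; apply: IHs.
Qed.

Lemma po_proj s v : pairwise_orthogonal ip s -> ~ lspan s v ->
  pairwise_orthogonal ip (v - orth_proj s v :: s).
Proof.
move=> os sv; rewrite po_cons os andbT; apply/andP; split.
  by apply/eqP => /subr0_eq v_proj; apply: sv; rewrite v_proj; apply: orth_proj_lspan.
by apply/orthP => x y; rewrite inE => /eqP -> /mem_lspan; apply: orth_proj_orth.
Qed.

(** The sizes may differ, because a vector already in the span of the rest is dropped. *)
Lemma gram_schmidt s : exists t,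
  [/\ pairwise_orthogonal ip t, lspan t = lspan s & (size t <= size s)%N].
Proof.
elim: s => [|x s [t [ot ts le_ts]]]; first by exists [::].
have [sx|sx] := pselect (lspan s x).
  exists t; split=> //; last exact: leqW.
  rewrite ts; apply/seteqP; split=> [y sy|].
    by exists 0 => //; exists y; rewrite ?scale0r ?add0r.
  apply: (lspan_sub (linear_lspan s)) => y.
  by rewrite inE => /predU1P[->//|]; apply: mem_lspan.
exists (x - orth_proj t x :: t); split=> //; first by apply: po_proj; rewrite ?ts.
have tx : lspan s (- orth_proj t x).
  by rewrite -ts -scaleN1r; apply: subspaceZ (linear_lspan t) (orth_proj_lspan t x).
by apply: lspan_shift.
Qed.

(** A [pairwise_orthogonal] list does not contain zero, so pairing a vanishing combination with a
    member isolates the coefficient of that member. *)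
Lemma po_indep s :
  pairwise_orthogonal ip s -> lin_indep (fun i : 'I_(size s) => s`_i).
Proof.
move=> os c c0 i; have /pairwise_orthogonalP[/=/andP[s0 us] oss] := os.
have si0 : s`_i != 0 by apply: contraNneq s0 => <-; apply: mem_nth.
have : ip (lincomb (fun i : 'I_(size s) => s`_i) c) s`_i = 0.
  by rewrite c0 linear0l.
rewrite /lincomb linear_sumlz (bigD1 i)//= big1 ?addr0 => [|j ji].
  by rewrite dotZl => /eqP; rewrite mulf_eq0 dnorm_eq0 (negPf si0) orbF => /eqP.
by rewrite dotZl oss ?mulr0 ?mem_nth// nth_uniq.
Qed.

Lemma po_has_dim s : pairwise_orthogonal ip s -> has_dim (size s) (lspan s).
Proof. by move=> /po_indep os; eexists; split; [exact: os|exact: lspan_nth]. Qed.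

Lemma has_dim_po n A : has_dim n A -> exists s,
  [/\ pairwise_orthogonal ip s, size s = n & A = lspan s].
Proof.
move=> [e [ie ->]]; have [t [ot ts le_ts]] := gram_schmidt (codom e).
have le_tn : (size t <= n)%N.
  by rewrite (leq_trans le_ts)// size_codom card_ord.
rewrite -lspan_codom; exists t; split; rewrite ?ts//; apply/eqP; rewrite eqn_leq le_tn /=.
apply: (lin_indep_leq ie) => i; rewrite ts; apply: mem_lspan.
exact: codom_f.
Qed.

Lemma po_size s t : pairwise_orthogonal ip s -> lspan s `<=` lspan t ->
  (size s <= size t)%N.
Proof.
move=> /po_indep /lin_indep_leq st sub; apply: st => i; apply: sub.
by apply: mem_lspan; apply: mem_nth.
Qed.

(** A vector of [lspan t] outside [lspan s], less its projection, would extend [s] to an orthogonal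
    list in [lspan t] longer than [t]. *)
Lemma po_span s t : pairwise_orthogonal ip s -> size s = size t ->
  lspan s `<=` lspan t -> lspan s = lspan t.
Proof.
move=> os st sub; apply/seteqP; split=> // x tx.
have [//|sx] := pselect (lspan s x).
suff /(po_size (po_proj os sx)) : lspan (x - orth_proj s x :: s) `<=` lspan t.
  by rewrite /= st ltnn.
move=> y [a _ [z sz <-]].
have lt := linear_lspan t; apply: subspaceD (sub _ sz) => //.
by apply: subspaceZ => //; apply: subspaceB => //; apply/sub/orth_proj_lspan.
Qed.

Lemma infinite_orth s : infinite_dimensional H ->
  exists v, v != 0 /\ orthogonal ip [:: v] s.
Proof.
move=> iH; have [t [ot ts _]] := gram_schmidt s.
have [v tv] : exists v, ~ lspan t v.
  apply: contra_notP iH => /forallNP tT; exists (size t).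
  rewrite (_ : setT = lspan t); first exact: po_has_dim.
  by apply/seteqP; split=> // x _; apply: contrapT.
exists (v - orth_proj t v); split.
  by apply/eqP => /subr0_eq v_proj; apply: tv; rewrite v_proj; apply: orth_proj_lspan.
apply/orthP => x y; rewrite inE => /eqP -> sy; apply: orth_proj_orth => //.
by rewrite ts; apply: mem_lspan.
Qed.

(** Source of all auxiliary blocks below: any finite list leaves room for [n] further orthogonal
    directions. *)
Lemma infinite_po n s : infinite_dimensional H -> exists t,
  [/\ pairwise_orthogonal ip t, size t = n & orthogonal ip t s].
Proof.
move=> iH; elim: n => [|n [t [ot tn ts]]].
  by exists [::]; split.
have [v [v0]] := infinite_orth (t ++ s) iH.
rewrite orth_catr => /andP[vt vs]; exists (v :: t); split.
- by rewrite po_cons v0 vt.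
- by rewrite /= tn.
- by rewrite orthogonal_cons vs.
Qed.

End Orthogonal.

(** * The lines associated with a map of subspaces *)

(** Orthogonality of concatenations is split into conditions on pairs of blocks; [po_auto] then
    finds each of them, up to symmetry, among the hypotheses. *)
Ltac po_hyps := repeat match goal with
  | h : is_true (pairwise_orthogonal _ (_ ++ _)) |- _ =>
      move: h; rewrite po_cat => /and3P[? ? ?]
  | h : is_true (orthogonal _ (_ ++ _) _) |- _ =>
      move: h; rewrite orth_catl => /andP[? ?]
  | h : is_true (orthogonal _ _ (_ ++ _)) |- _ =>
      move: h; rewrite orth_catr => /andP[? ?]
  end.

Ltac po_auto := solve [po_hyps; rewrite ?(po_cat, orth_catl, orth_catr);
  repeat match goal with |- is_true (_ && _) => apply/andP; split end;
  try assumption; rewrite orthC; assumption].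

Section SubspaceMap.
Variables (C : numClosedFieldType) (H : lmodType C).
Variables (ip : {dot H for conjC}) (n : nat) (F : set H -> set H).
Implicit Types (s t w U V : seq H) (x y z e : H).

Local Notation po := (pairwise_orthogonal ip).
Local Notation orth := (orthogonal ip).

Hypothesis infH : infinite_dimensional H.
(** [F] acts on all sets; these assumptions constrain it only on spans of [n.+1] orthogonal vectors,
    so that [n] is the size of a block completing one vector. *)
Hypothesis F_dim : forall s, po s -> size s = n.+1 ->
  exists t, [/\ po t, size t = n.+1 & F (lspan s) = lspan t].
Hypothesis F_inj : forall s t, po s -> size s = n.+1 -> po t -> size t = n.+1 ->
  F (lspan s) = F (lspan t) -> lspan s = lspan t.
Hypothesis F_orth : forall s t, po (s ++ t) -> size s = n.+1 -> size t = n.+1 ->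
  forall x y, F (lspan s) x -> F (lspan t) y -> ip x y = 0.
Hypothesis F_sum : forall s t w, po (s ++ t) -> po w ->
  size s = n.+1 -> size t = n.+1 -> size w = n.+1 ->
  lspan w `<=` lspan (s ++ t) ->
  F (lspan w) `<=` sum_subspace (F (lspan s)) (F (lspan t)).

Lemma linear_F s : po s -> size s = n.+1 -> linear_subspace (F (lspan s)).
Proof. by move=> os /(F_dim os)[t [_ _ ->]]; apply: linear_lspan. Qed.

(** Four orthogonal blocks form a square: [E + U] and [E' + U'] are opposite corners, and their sum
    contains the corner [E' + U]. *)
Lemma F_cat_sum E E' U U' :
  po (E ++ E' ++ U ++ U') ->
  size (E ++ U) = n.+1 -> size (E' ++ U') = n.+1 ->
  size (E' ++ U) = n.+1 ->
  F (lspan (E' ++ U)) `<=` sum_subspace (F (lspan (E ++ U))) (F (lspan (E' ++ U'))).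
Proof.
move=> o sEU sEU' s'; apply: F_sum => //; try po_auto.
by apply: lspan_mono => x; rewrite !mem_cat => /orP[] ->; rewrite ?orbT.
Qed.

(* Writing v = a + b along F (E' + U) and F (E + U'), the component b is the
   same when U' is replaced with U'', which forces b into F (E + U) as well. *)
Lemma F_exchange E E' U U' U'' v :
  po (E ++ E' ++ U ++ U' ++ U'') -> size E' = size E ->
  size (E ++ U) = n.+1 -> size U' = size U -> size U'' = size U ->
  F (lspan (E ++ U)) v -> exists a b,
  [/\ v = a + b, F (lspan (E' ++ U)) a, F (lspan (E ++ U)) b
    & F (lspan (E ++ U')) b].
Proof.
move=> o sE sU sU' sU'' Av.
have size_E'U : size (E' ++ U) = n.+1 by rewrite -sU !size_cat sE.
have size_EU' : size (E ++ U') = n.+1 by rewrite -sU !size_cat sU'.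
have size_E'U' : size (E' ++ U') = n.+1 by rewrite -sU !size_cat sU' sE.
have size_EU'' : size (E ++ U'') = n.+1 by rewrite -sU !size_cat sU''.
have size_E'U'' : size (E' ++ U'') = n.+1 by rewrite -sU !size_cat sU'' sE.
have [a A'a [b Bb vab]] : sum_subspace (F (lspan (E' ++ U))) (F (lspan (E ++ U'))) v.
  by apply: F_cat_sum Av => //; po_auto.
have [a' A'a' [c Cc vac]] :
    sum_subspace (F (lspan (E' ++ U))) (F (lspan (E ++ U''))) v.
  by apply: F_cat_sum Av => //; po_auto.
(* The difference [b - c = a' - a] lies in [F (E' + U)], to which both [b] and [c] are
   orthogonal. *)
have bc : b = c.
  apply/eqP; rewrite -subr_eq0; apply/eqP/(@dot_self0 _ _ ip).
  have A'bc : F (lspan (E' ++ U)) (b - c).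
    have -> : b - c = a' - a.
      by apply/eqP; rewrite subr_eq addrAC vac -vab addrC addKr.
    by apply: subspaceB => //; apply: linear_F => //; po_auto.
  rewrite dotBl (F_orth _ _ _ Bb A'bc) ?(F_orth _ _ _ Cc A'bc) ?subrr//; po_auto.
exists a, b; split=> //.
have [a1 Aa1 [b' B'b' ba1]] :
    sum_subspace (F (lspan (E ++ U))) (F (lspan (E' ++ U'))) b.
  by apply: F_sum Bb => //; try po_auto; apply: lspan_mono => x;
    rewrite !mem_cat => /orP[] ->; rewrite ?orbT.
(* [b - a1 = b'] lies in [F (E' + U')], to which [a1] in [F (E + U)] and [b = c] in [F (E + U'')]
   are both orthogonal. *)
suff -> : b = a1 by [].
apply/eqP; rewrite -subr_eq0; apply/eqP/(@dot_self0 _ _ ip).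
have B'ba : b - a1 = b' by rewrite -ba1 addrC addKr.
rewrite {2}B'ba dotBl (F_orth _ _ _ Aa1 B'b')//; last by po_auto.
rewrite bc in ba1 *.
by rewrite (F_orth _ _ _ Cc B'b') ?subrr//; po_auto.
Qed.

(** Write [b = a + c] along [F (E' + U)] and [F (E + U'')]. Since [b] is also in [F (E + U')], both
    [b] and [c] are orthogonal to [F (E' + U)], so [a = b - c] vanishes. *)
Lemma F_inter_indep E E' U U' U'' b :
  po (E ++ E' ++ U ++ U' ++ U'') -> size E' = size E ->
  size (E ++ U) = n.+1 -> size U' = size U -> size U'' = size U ->
  F (lspan (E ++ U)) b -> F (lspan (E ++ U')) b ->
  F (lspan (E ++ U'')) b.
Proof.
move=> o sE sU sU' sU'' Ab Bb.
have size_E'U : size (E' ++ U) = n.+1 by rewrite -sU !size_cat sE.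
have size_EU' : size (E ++ U') = n.+1 by rewrite -sU !size_cat sU'.
have size_E'U' : size (E' ++ U') = n.+1 by rewrite -sU !size_cat sU' sE.
have size_EU'' : size (E ++ U'') = n.+1 by rewrite -sU !size_cat sU''.
have size_E'U'' : size (E' ++ U'') = n.+1 by rewrite -sU !size_cat sU'' sE.
have [a A'a [c Cc bac]] :
    sum_subspace (F (lspan (E' ++ U))) (F (lspan (E ++ U''))) b.
  by apply: F_cat_sum Ab => //; po_auto.
suff a0 : a = 0 by rewrite -bac a0 add0r.
apply: (@dot_self0 _ _ ip); have {1}-> : a = b - c by rewrite -bac addrK.
by rewrite dotBl (F_orth _ _ _ Bb A'a) ?(F_orth _ _ _ Cc A'a) ?subrr//; po_auto.
Qed.

(** Images have equal dimension, so the inclusion is an equality and injectivity applies. *)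
Lemma F_eq s t : po s -> size s = n.+1 -> po t -> size t = n.+1 ->
  F (lspan s) `<=` F (lspan t) -> lspan s = lspan t.
Proof.
move=> os ss ot st; have [s' [os' ss' Fs]] := F_dim os ss.
have [t' [ot' st' Ft]] := F_dim ot st.
move=> sub; apply: F_inj => //; rewrite Fs Ft.
by apply: (po_span os'); rewrite ?ss' ?st'// -Fs -Ft.
Qed.

(** Otherwise the component [b] given by [F_exchange] always vanishes and [F (e + U)] lies in
    [F (e' + U)]. Then [e] lies in [e' + U], to which it is orthogonal. *)
Lemma F_inter_neq0 e e' U U' U'' :
  po ([:: e] ++ [:: e'] ++ U ++ U' ++ U'') ->
  size U = n -> size U' = n -> size U'' = n -> exists b,
  [/\ b != 0, F (lspan ([:: e] ++ U)) b & F (lspan ([:: e] ++ U')) b].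
Proof.
move=> o sU sU' sU''; apply: contrapT => none.
suff /F_eq eU : F (lspan ([:: e] ++ U)) `<=` F (lspan ([:: e'] ++ U)).
  have e_span : lspan ([:: e'] ++ U) e.
    rewrite -eU ?size_cat ?sU//; try po_auto.
    by apply: mem_lspan; rewrite mem_head.
  have : e != 0 by move: o; rewrite po_cons => /andP[].
  apply/negP; rewrite negbK; apply/eqP/(@dot_self0 _ _ ip).
  apply: (@orth_lspan _ _ ip [:: e]) e_span; first by po_auto.
  by apply: mem_lspan; rewrite mem_head.
move=> v Av.
have [||||a [b [-> A'a Ab Bb]]] := F_exchange o _ _ _ _ Av;
  rewrite ?size_cat ?sU ?sU' ?sU''//.
have [b0|b0] := eqVneq b 0; first by rewrite b0 addr0.
by case: none; exists b.
Qed.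

(** The subspace E(e) of the overview, each subspace through [e] being given by an orthogonal basis
    that starts with [e]. The condition is void for [e = 0]. *)
Definition axis e : set H :=
  [set b | forall U, size U = n -> po ([:: e] ++ U) -> F (lspan ([:: e] ++ U)) b].

Lemma axis_neq0 e : e != 0 -> exists b, b != 0 /\ axis e b.
Proof.
move=> e0; have oe : po [:: e] by rewrite po_cons e0.
have [e' [oe' se' e'e]] := infinite_po ip 1 [:: e] infH.
case: e' se' oe' e'e => [|e' []]// _ oe' e'e.
have [U [oU sU Ue]] := infinite_po ip n ([:: e] ++ [:: e']) infH.
have [U' [oU' sU' U'e]] := infinite_po ip n ([:: e] ++ [:: e'] ++ U) infH.
have [U'' [oU'' sU'' U''e]] :=
  infinite_po ip n ([:: e] ++ [:: e'] ++ U ++ U') infH.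
have [||||b [b0 Ab Bb]] := @F_inter_neq0 e e' U U' U''; rewrite //; first by po_auto.
exists b; split=> // V sV oV.
(* [V] need not be orthogonal to [U] and [U']. Hence [b] passes first to [W] and [W'], chosen
   orthogonal to [U], [U'] and [V], and from these to [V]; [d] serves as the block [E']. *)
have [W [oW sW We]] := infinite_po ip n ([:: e] ++ U ++ U' ++ V) infH.
have [W' [oW' sW' W'e]] := infinite_po ip n ([:: e] ++ U ++ U' ++ V ++ W) infH.
have [d [od sd de]] := infinite_po ip 1 ([:: e] ++ U ++ U' ++ V ++ W ++ W') infH.
have FW : F (lspan ([:: e] ++ W)) b.
  by apply: (@F_inter_indep [:: e] d U U') => //; rewrite ?size_cat ?sU ?sU' ?sW//; po_auto.
have FW' : F (lspan ([:: e] ++ W')) b.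
  by apply: (@F_inter_indep [:: e] d U U') => //; rewrite ?size_cat ?sU ?sU' ?sW'//; po_auto.
by apply: (@F_inter_indep [:: e] d W W') => //; rewrite ?size_cat ?sW ?sV ?sW'//; po_auto.
Qed.

(** The nonzero vector chosen on each axis is arbitrary, so [phi] carries information only up to
    scalars. *)
Lemma exists_axis_map : exists phi : H -> H,
  phi 0 = 0 /\ forall x, x != 0 -> phi x != 0 /\ axis x (phi x).
Proof.
suff /choice[phi phiP] : forall x, exists b,
    if x == 0 then b = 0 else b != 0 /\ axis x b.
  exists phi; split=> [|x /negPf x0]; first by have := phiP 0; rewrite eqxx.
  by have := phiP x; rewrite x0.
by move=> x; case: eqVneq => [_|/axis_neq0//]; exists 0.
Qed.

(** * The map of lines given by the axes *)

Section AxisMap.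
Variable phi : H -> H.
Hypothesis phi_axis : forall x, x != 0 -> phi x != 0 /\ axis x (phi x).

Lemma axis_map_orth x y : x != 0 -> y != 0 -> ip x y = 0 -> ip (phi x) (phi y) = 0.
Proof.
move=> x0 y0 xy; have [_ Ax] := phi_axis x0; have [_ Ay] := phi_axis y0.
have ox : po [:: x] by rewrite po_cons x0.
have oy : po [:: y] by rewrite po_cons y0.
have oxy : orth [:: x] [:: y] by apply/orthP => ? ?; rewrite !inE => /eqP-> /eqP->.
have [U [oU sU Ue]] := infinite_po ip n ([:: x] ++ [:: y]) infH.
have [V [oV sV Ve]] := infinite_po ip n ([:: x] ++ [:: y] ++ U) infH.
by apply: F_orth (Ax U sU _) (Ay V sV _); rewrite ?size_cat ?sU ?sV//; po_auto.
Qed.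

Lemma axis_map_neq0 x : x != 0 -> phi x != 0.
Proof. by move=> /phi_axis[]. Qed.

Lemma po_neq0 s x : po s -> x \in s -> x != 0.
Proof. by case/andP=> s0 _; apply: contraTneq => ->. Qed.

Lemma po_map_axis s : po s -> po (map phi s).
Proof.
elim: s => // x s IHs; rewrite map_cons !po_cons => /and3P[x0 /orthP xs os].
rewrite axis_map_neq0// IHs// andbT; apply/orthP => _ _ /[!inE]/eqP-> /mapP[y ys ->].
by apply: axis_map_orth => //; rewrite ?(po_neq0 os ys)// xs ?inE.
Qed.

(** The images of the basis are [n.+1] nonzero orthogonal vectors in a subspace of dimension
    [n.+1]. *)
Lemma lspan_map_axis s : po s -> size s = n.+1 -> lspan (map phi s) = F (lspan s).
Proof.
move=> os ss; have [t [ot st Fs]] := F_dim os ss; rewrite Fs.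
apply: (po_span (po_map_axis os)); rewrite ?size_map ?ss// -Fs.
apply: (lspan_sub (linear_F os ss)) => _ /mapP[x xs ->].
have x0 := po_neq0 os xs; have [_ Ax] := phi_axis x0.
(* [axis] expects the distinguished vector at the head of the list. *)
have sx : perm_eq s ([:: x] ++ rem x s) by rewrite perm_to_rem.
have -> : lspan s = lspan ([:: x] ++ rem x s).
  by apply/seteqP; split; apply: lspan_mono => z; rewrite (perm_mem sx).
apply: Ax; first by rewrite size_rem// ss.
have /pairwise_orthogonalP[/= /andP[s0 us] oss] := os.
apply/pairwise_orthogonalP; split=> [|y z]; last first.
  by rewrite -!(perm_mem sx); apply: oss.
by rewrite cons_uniq -(perm_mem sx) -(perm_uniq sx) s0.
Qed.

(** Complete [x] and [y] by orthogonal blocks [U] and [V]. Then [phi z] lies in the span of the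
    images of [x], [y], [U] and [V], and it is orthogonal to those of [U] and [V] because [z] is
    orthogonal to both blocks. *)
Lemma axis_map_line x y a b (z := a *: x + b *: y) :
  x != 0 -> y != 0 -> ip x y = 0 -> z != 0 ->
  exists c d, phi z = c *: phi x + d *: phi y.
Proof.
move=> x0 y0 xy z0; have [_ Az] := phi_axis z0.
have ox : po [:: x] by rewrite po_cons x0.
have oy : po [:: y] by rewrite po_cons y0.
have oz : po [:: z] by rewrite po_cons z0.
have oxy : orth [:: x] [:: y] by apply/orthP => ? ?; rewrite !inE => /eqP-> /eqP->.
have [U [oU sU Ue]] := infinite_po ip n ([:: x] ++ [:: y]) infH.
have [V [oV sV Ve]] := infinite_po ip n ([:: x] ++ [:: y] ++ U) infH.
have zU : orth [:: z] (U ++ V).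
  apply/orthP => z' w; rewrite inE => /eqP -> wUV.
  have oxyUV : orth ([:: x] ++ [:: y]) (U ++ V) by po_auto.
  apply: (orth_lspan oxyUV); last exact: mem_lspan.
  by apply: lspan_cons; exists b => //; exists 0; rewrite ?addr0.
have [p xp [q yq pq]] : sum_subspace (F (lspan ([:: x] ++ U))) (F (lspan ([:: y] ++ V))) (phi z).
  apply: F_sum (Az U sU _); rewrite ?size_cat ?sU ?sV//; try po_auto.
  apply: lspan_sub; first exact: linear_lspan.
  move=> z'; rewrite mem_cat inE => /predU1P[->|wU]; last first.
    by apply: mem_lspan; rewrite !mem_cat wU orbT.
  have lS := linear_lspan (([:: x] ++ U) ++ [:: y] ++ V).
  by apply: subspaceD => //; apply: subspaceZ => //; apply: mem_lspan;
    rewrite !(mem_cat, mem_head, orbT).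
have oUV : po (U ++ V) by po_auto.
have oxyUV : po (([:: x] ++ [:: y]) ++ (U ++ V)) by po_auto.
move: xp yq; rewrite -!lspan_map_axis ?size_cat ?sU ?sV//; try po_auto.
move=> [c _ [u uU cu]] [d _ [v vV dv]].
exists c, d; have := po_map_axis oxyUV; rewrite map_cat po_cat => /and3P[_ _ oo].
have uvUV : lspan (map phi (U ++ V)) (u + v).
  by rewrite map_cat lspan_cat; exists u => //; exists v.
suff uv0 : u + v = 0 by rewrite -pq -cu -dv addrACA uv0 addr0.
apply: (@dot_self0 _ _ ip).
have {1}-> : u + v = phi z - (c *: phi x + d *: phi y).
  by rewrite -pq -cu -dv addrACA [X in _ = X - _]addrC addrK.
rewrite dotBl [X in _ - X](orth_lspan oo) ?subr0//; last first.
  by apply: lspan_cons; exists d => //; exists 0; rewrite ?addr0.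
have ozUV : po ([:: z] ++ (U ++ V)) by po_auto.
have := po_map_axis ozUV; rewrite map_cat po_cat => /and3P[_ _ /orth_lspan]; apply=> //.
by apply: mem_lspan; rewrite mem_head.
Qed.

(** For [U] orthogonal to both vectors, [F_eq] gives [y + U = x + U]. The component along [U] of
    [y - d *: x] then vanishes by orthogonality. *)
Lemma axis_map_inj x y c : x != 0 -> y != 0 -> phi y = c *: phi x ->
  exists d, y = d *: x.
Proof.
move=> x0 y0 yx.
have ox : po [:: x] by rewrite po_cons x0.
have oy : po [:: y] by rewrite po_cons y0.
have [U [oU sU Ue]] := infinite_po ip n ([:: x] ++ [:: y]) infH.
have oxU : po ([:: x] ++ U) by po_auto.
have oyU : po ([:: y] ++ U) by po_auto.
have : lspan ([:: y] ++ U) = lspan ([:: x] ++ U).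
  apply: F_eq; rewrite ?size_cat ?sU//; rewrite -!lspan_map_axis ?size_cat ?sU//.
  apply: (lspan_sub (linear_lspan _)) => w; rewrite map_cat mem_cat inE.
  move=> /predU1P[->|wU]; last by apply: mem_lspan; rewrite map_cat mem_cat wU orbT.
  rewrite yx; apply: subspaceZ (linear_lspan _) _; apply: mem_lspan.
  by rewrite mem_head.
move=> /seteqP[+ _] => /(_ y)[|d _ [u uU yu]]; first by apply: mem_lspan; exact: mem_head.
exists d; suff u0 : u = 0 by rewrite -yu u0 addr0.
apply: (@dot_self0 _ _ ip); have {1}-> : u = y - d *: x by rewrite -yu addrC addKr.
have yxU : orth ([:: x] ++ [:: y]) U by po_auto.
apply: (orth_lspan yxU) uU; have lS := linear_lspan ([:: x] ++ [:: y]).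
by apply: subspaceB => //; try apply: subspaceZ => //; apply: mem_lspan;
  rewrite !(mem_cat, mem_head, orbT).
Qed.

End AxisMap.
End SubspaceMap.

(** * Field morphisms commuting with conjugation *)

Section ConjCommutingMorphism.
Variables (R : realType) (s : {rmorphism R[i] -> R[i]}).
Hypothesis s_conj : forall a, s a^* = (s a)^*.

(** A nonnegative number has the form [z * z^*], and [s] preserves this form. *)
Lemma conj_morph_ge0 a : 0 <= a -> 0 <= s a.
Proof.
move=> a0; have -> : a = sqrtC a * (sqrtC a)^*.
  by rewrite -normCK ger0_norm ?sqrtC_ge0// sqrtCK.
by rewrite rmorphM/= s_conj mul_conjC_ge0.
Qed.

Lemma conjcE (z : R[i]) : z^* = z^*%C.
Proof. by []. Qed.

(* A positive ring morphism of the reals is squeezed by the rationals. *)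
Lemma conj_morph_real (r : R) : s r%:C%C = r%:C%C.
Proof.
have s_rat (q : rat) : s (ratr q : R)%:C%C = (ratr q : R)%:C%C.
  by rewrite !(fmorph_rat (real_complex R)) fmorph_rat.
have s_real (x : R) : exists y : R, s x%:C%C = y%:C%C.
  have : s x%:C%C \is Num.real by apply/CrealP; rewrite -s_conj conjcE conjc_real.
  by move=> /complex_realP.
have s_mono (x y : R) : x <= y -> s x%:C%C <= s y%:C%C.
  move=> xy; rewrite -subr_ge0 -rmorphB -rmorphB /=.
  by apply: conj_morph_ge0; rewrite ler0c subr_ge0.
have [y sr] := s_real r; rewrite sr; congr (_%:C)%C.
apply/eqP; case: ltgtP => // /rat_in_itvoo[q]; rewrite in_itv /= => /andP[q1 q2].
  by have := s_mono _ _ (ltW q2); rewrite s_rat sr lecR leNgt q1.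
by have := s_mono _ _ (ltW q1); rewrite s_rat sr lecR leNgt q2.
Qed.

(** The image of the imaginary unit is a square root of -1, which leaves two signs. *)
Lemma conj_morph_id_or_conj : (forall a, s a = a) \/ (forall a, s a = a^*).
Proof.
have /eqP : s 'i%C ^+ 2 = 'i%C ^+ 2 by rewrite -rmorphXn /= sqr_i rmorphN1.
rewrite eqf_sqr => /orP[] /eqP si; [left|right] => a.
  by rewrite [in RHS](complexE a) [in LHS](complexE a) rmorphD rmorphM /= si !conj_morph_real.
rewrite [in LHS](complexE a) rmorphD rmorphM /= si !conj_morph_real conjcE.
by case: a => x y; simpc.
Qed.
End ConjCommutingMorphism.

(** * Orthogonality preserving maps of lines *)

Section OrthogonalLineation.
Variables (C : numClosedFieldType) (H : lmodType C).
Variables (ip : {dot H for conjC}) (phi : H -> H).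
Implicit Types (x y z v w : H) (a b c d t : C).

Hypothesis infH : infinite_dimensional H.
Hypothesis phi_at0 : phi 0 = 0.
Hypothesis phi_neq0 : forall x, x != 0 -> phi x != 0.
Hypothesis phi_orth : forall x y,
  x != 0 -> y != 0 -> ip x y = 0 -> ip (phi x) (phi y) = 0.
Hypothesis phi_orth_line : forall x y a b, x != 0 -> y != 0 -> ip x y = 0 ->
  a *: x + b *: y != 0 ->
  exists c d, phi (a *: x + b *: y) = c *: phi x + d *: phi y.
Hypothesis phi_inj : forall x y c, x != 0 -> y != 0 -> phi y = c *: phi x ->
  exists d, y = d *: x.

Lemma infinite_orth3 x y w :
  exists z, [/\ z != 0, ip z x = 0, ip z y = 0 & ip z w = 0].
Proof.
have [z [z0 /orthP zxy]] := infinite_orth ip [:: x; y; w] infH.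
by exists z; split=> //; apply: zxy; rewrite !inE eqxx ?orbT.
Qed.

Lemma phi_dot0 x y : ip x y = 0 -> ip (phi x) (phi y) = 0.
Proof.
move=> xy; have [->|x0] := eqVneq x 0; first by rewrite phi_at0 linear0l.
have [->|y0] := eqVneq y 0; first by rewrite phi_at0 linear0r.
exact: phi_orth.
Qed.

(** View [a *: x] in the plane of [x] and an orthogonal [y]: the component along [phi y] vanishes,
    as [phi (a *: x)] and [phi x] are orthogonal to [phi y]. *)
Lemma phi_scale a x : exists c, phi (a *: x) = c *: phi x.
Proof.
have [->|ax0] := eqVneq (a *: x) 0.
  by exists 0; rewrite phi_at0 scale0r.
have x0 : x != 0 by apply: contraNneq ax0 => ->; rewrite scaler0.
have [y [y0 yx _ _]] := infinite_orth3 x x x.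
have [|c [d pax]] := @phi_orth_line x y a 0 x0 y0 (dot0C yx).
  by rewrite scale0r addr0.
rewrite scale0r addr0 in pax; exists c.
suff d0 : d *: phi y = 0 by rewrite pax d0 addr0.
apply: (@dot_self0 _ _ ip); have {1}-> : d *: phi y = phi (a *: x) - c *: phi x.
  by rewrite pax addrC addKr.
rewrite dotZr dotBl dotZl !phi_dot0 ?mulr0 ?subr0 ?mulr0//.
  exact: dot0C.
by rewrite dotZl (dot0C yx) mulr0.
Qed.

(** Removes the orthogonality from [phi_orth_line]: with [y'] the part of [y] orthogonal to [x], the
    vector [phi y'] is eliminated between the expressions of [phi y] and of the image of the
    combination. *)
Lemma phi_line x y a b : x != 0 ->
  exists c d, phi (a *: x + b *: y) = c *: phi x + d *: phi y.
Proof.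
move=> x0; have [[k ->]|yx] := pselect (exists k, y = k *: x).
  have [c pc] := phi_scale (a + b * k) x.
  by exists c, 0; rewrite scale0r addr0 -pc scalerDl scalerA.
have [z0|z0] := eqVneq (a *: x + b *: y) 0.
  by exists 0, 0; rewrite z0 phi_at0 !scale0r addr0.
pose t := ip y x / ip x x; pose y' := y - t *: x.
have xy' : ip x y' = 0.
  by apply: dot0C; rewrite dotBl dotZl divfK ?subrr// dnorm_eq0.
have yE : y = t *: x + 1 *: y' by rewrite scale1r addrC subrK.
have y'0 : y' != 0.
  by apply/eqP => /subr0_eq y_tx; apply: yx; exists t.
have y0 : y != 0.
  by apply/eqP => y0; apply: yx; exists 0; rewrite scale0r.
have [|c1 [d1 py]] := @phi_orth_line x y' t 1 x0 y'0 xy'; first by rewrite -yE.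
rewrite -yE in py.
have d10 : d1 != 0.
  apply/eqP => d10; apply: yx; apply: (phi_inj (c := c1)) => //.
  by rewrite py d10 scale0r addr0.
have zE : a *: x + b *: y = (a + b * t) *: x + b *: y'.
  by rewrite yE scale1r scalerDr scalerA addrA -scalerDl.
have [|c [d pz]] := @phi_orth_line x y' (a + b * t) b x0 y'0 xy'.
  by rewrite -zE.
exists (c - d / d1 * c1), (d / d1).
rewrite zE pz py scalerDr !scalerA divfK// addrA -scalerDl subrK //.
Qed.

(** * The affine chart [e0 + x], with [x] orthogonal to the unit vector [e0] *)

Variable e0 : H.
Hypothesis e01 : ip e0 e0 = 1.
Variables (u : H) (c0 : C).
Hypothesis u_phi : phi e0 = c0 *: u.
Hypothesis u1 : ip u u = 1.

Let e0_neq0 : e0 != 0.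
Proof. by apply/eqP => e; move/eqP: e01; rewrite e linear0l eq_sym oner_eq0. Qed.

Let c0_neq0 : c0 != 0.
Proof.
by apply: contraNneq (phi_neq0 e0_neq0) => c00; rewrite u_phi c00 scale0r.
Qed.

Lemma dot_phi_u x : ip x e0 = 0 -> ip (phi x) u = 0.
Proof.
move=> xe; have := phi_dot0 xe; rewrite u_phi dotZr => /eqP.
by rewrite mulf_eq0 conjC_eq0 (negPf c0_neq0) => /eqP.
Qed.

Lemma e0D_neq0 x : ip x e0 = 0 -> e0 + x != 0.
Proof.
move=> xe; apply/eqP => ex0; have : ip (e0 + x) e0 = 0 by rewrite ex0 linear0l.
by rewrite dotDl e01 xe addr0 => /eqP; rewrite oner_eq0.
Qed.

(** Expand [phi (e0 + x)] along [u] and [phi x], then divide by the coefficient of [u]. *)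
Lemma psi_exists x : ip x e0 = 0 ->
  exists w, (exists c, w = c *: phi x) /\ (exists d, phi (e0 + x) = d *: (u + w)).
Proof.
move=> xe; have [->|x0] := eqVneq x 0.
  exists 0; split; first by exists 0; rewrite scale0r.
  by exists c0; rewrite !addr0.
have [c [d pex]] := @phi_line e0 x 1 1 e0_neq0; rewrite !scale1r in pex.
(* With [c = 0], injectivity on lines would make [e0 + x], hence [e0], a multiple of [x], which is
   orthogonal to [e0]. *)
have cc0 : c * c0 != 0.
  rewrite mulf_neq0//; apply/eqP => c00.
  have ex0 := e0D_neq0 xe.
  have [|k ekx] := phi_inj (c := d) x0 ex0; first by rewrite pex c00 scale0r add0r.
  have : ip e0 e0 = 0.
    rewrite [X in ip X _](_ : e0 = (k - 1) *: x) ?dotZl ?xe ?mulr0//.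
    by rewrite scalerBl scale1r -ekx addrK.
  by rewrite e01 => /eqP; rewrite oner_eq0.
exists (d / (c * c0) *: phi x); split; first by eexists.
exists (c * c0); by rewrite scalerDr scalerA [X in X *: phi x]mulrC divfK// pex u_phi scalerA.
Qed.
(* [psi x] rescales [phi x] so that [u + psi x] spans the line of [e0 + x]. *)
Variable psi : H -> H.
Hypothesis psiP : forall x, ip x e0 = 0 ->
  (exists c, psi x = c *: phi x) /\ (exists d, phi (e0 + x) = d *: (u + psi x)).

Let M x := ip x e0 = 0.

Let MD x y : M x -> M y -> M (x + y).
Proof. by move=> Mx My; rewrite /M dotDl Mx My addr0. Qed.

Let MZ a x : M x -> M (a *: x).
Proof. by move=> Mx; rewrite /M dotZl Mx mulr0. Qed.

Lemma psi_dot0 x y : M x -> M y -> ip x y = 0 -> ip (psi x) (psi y) = 0.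
Proof.
move=> /psiP[[c ->] _] /psiP[[d ->] _] xy.
by rewrite dotZl dotZr phi_dot0// !mulr0.
Qed.

Lemma dot_psi_u x : M x -> ip (psi x) u = 0.
Proof.
by move=> Mx; have [[c ->] _] := psiP Mx; rewrite dotZl dot_phi_u ?mulr0.
Qed.

Lemma psi_e0 x : M x -> exists d, d != 0 /\ phi (e0 + x) = d *: (u + psi x).
Proof.
move=> Mx; have [_ [d pd]] := psiP Mx; exists d; split=> //.
by apply: contraNneq (phi_neq0 (e0D_neq0 Mx)) => d0; rewrite pd d0 scale0r.
Qed.

(** Pairing with [u] fixes the factor [d], and thereby [w]. *)
Lemma psi_unique x w d : M x -> ip w u = 0 -> phi (e0 + x) = d *: (u + w) ->
  w = psi x.
Proof.
move=> Mx wu pw; have [d' [d'0 pd']] := psi_e0 Mx.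
have dd' : d = d'.
  have := congr1 (fun v => ip v u) pw; rewrite pd' !dotZl !dotDl wu.
  by rewrite (dot_psi_u Mx) u1 addr0 !mulr1.
by apply: (addrI u); apply: (scalerI d'0); rewrite -{1}dd' -pw.
Qed.

Lemma psi_at0 : psi 0 = 0.
Proof.
have [|[c ->] _] := @psiP 0; first exact: linear0l.
by rewrite phi_at0 scaler0.
Qed.

Lemma psi_neq0 x : M x -> x != 0 -> psi x != 0.
Proof.
move=> Mx x0; apply/eqP => px0; have [d [d0 pd]] := psi_e0 Mx.
have [|k ek] := @phi_inj e0 (e0 + x) (d / c0) e0_neq0 (e0D_neq0 Mx).
  by rewrite pd px0 addr0 u_phi scalerA divfK.
have xE : x = (k - 1) *: e0 by rewrite scalerBl scale1r -ek addrC addKr.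
move: Mx; rewrite /M xE dotZl e01 mulr1 => k1.
by move: x0; rewrite xE k1 scale0r eqxx.
Qed.

Lemma phi_psi x : M x -> exists c, phi x = c *: psi x.
Proof.
move=> Mx; have [->|x0] := eqVneq x 0; first by exists 0; rewrite scale0r.
have [[c pc] _] := psiP Mx; exists c^-1.
have c0' : c != 0.
  by apply: contraNneq (psi_neq0 Mx x0) => c'0; rewrite pc c'0 scale0r.
by rewrite pc scalerA mulVf// scale1r.
Qed.

(* The line of [e0 + x + y] lies in two planes, one through [e0 + x] and [y],
   the other through [e0 + y] and [x]. *)
Lemma psiD_indep x y : M x -> M y -> x != 0 -> ~ (exists k, y = k *: x) ->
  psi (x + y) = psi x + psi y.
Proof.
move=> Mx My x0 yx.
have y0 : y != 0 by apply/eqP => y0; apply: yx; exists 0; rewrite scale0r.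
have [[cx px] _] := psiP Mx; have [[cy py] _] := psiP My.
have [dx [_ pex]] := psi_e0 Mx; have [dy [_ pey]] := psi_e0 My.
have [fx pfx] := phi_psi Mx; have [fy pfy] := phi_psi My.
have [a [b pe1]] := @phi_line (e0 + x) y 1 1 (e0D_neq0 Mx).
have [a' [b' pe2]] := @phi_line (e0 + y) x 1 1 (e0D_neq0 My).
rewrite !scale1r pex pfy scalerA (scalerA b) in pe1.
rewrite !scale1r pey pfx scalerA (scalerA b') in pe2.
set p := a * dx in pe1; set q := b * fy in pe1.
set p' := a' * dy in pe2; set q' := b' * fx in pe2.
(* Coefficients of [u] in the two expansions. *)
have pp' : p = p'.
  have := congr1 (fun v => ip v u) pe1; rewrite addrAC pe2 !dotDl !dotZl !dotDl.
  by rewrite !dot_psi_u// u1 !mulr0 !addr0 !mulr1.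
have eq_psi : (p - q') *: psi x = (p - q) *: psi y.
  have := pe2; rewrite addrAC pe1 -pp' !scalerDr -!addrA => /addrI e.
  by rewrite !scalerBl -(addrK (q *: psi y) (p *: psi x)) e [p *: psi y + _]addrC
    addrAC [q' *: _ + _]addrC addrK.
(* Otherwise [psi y] is a multiple of [psi x], and injectivity on lines makes [y] a multiple of
   [x]. *)
have pq : p = q.
  apply/eqP; rewrite -subr_eq0; apply/eqP; apply: contrapT => /eqP pq.
  apply: yx; apply: (phi_inj (c := fy * ((p - q)^-1 * ((p - q') * cx)))) => //.
  by rewrite pfy -!scalerA -px eq_psi scalerK.
rewrite -pq -scalerDr in pe1; apply/esym; apply: (psi_unique (d := p)).
- exact: MD.
- by rewrite dotDl !dot_psi_u// addr0.
- by rewrite addrA pe1 addrA.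
Qed.

Lemma psiD_orth x y : M x -> M y -> ip x y = 0 -> psi (x + y) = psi x + psi y.
Proof.
move=> Mx My xy; have [->|x0] := eqVneq x 0; first by rewrite psi_at0 !add0r.
have [->|y0] := eqVneq y 0; first by rewrite psi_at0 !addr0.
apply: psiD_indep => // -[k yk]; have /eqP := xy.
rewrite yk dotZr mulf_eq0 conjC_eq0 dnorm_eq0 (negPf x0) orbF => /eqP k0.
by move: y0; rewrite yk k0 scale0r eqxx.
Qed.

(** In the collinear case add a [z] orthogonal to both: [x] and [y + z] are independent, and [psi z]
    cancels in the end. *)
Lemma psiD x y : M x -> M y -> psi (x + y) = psi x + psi y.
Proof.
move=> Mx My; have [->|x0] := eqVneq x 0; first by rewrite psi_at0 !add0r.
have [[k yk]|] := pselect (exists k, y = k *: x); last exact: psiD_indep.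
have [z [z0 Mz zx _]] := infinite_orth3 e0 x x; have xz := dot0C zx.
have yz : ip y z = 0 by rewrite yk dotZl xz mulr0.
have xyz : ip (x + y) z = 0 by rewrite dotDl xz yz addr0.
apply: (addIr (psi z)); rewrite -(psiD_orth (MD Mx My) Mz xyz) -!addrA -(psiD_orth My Mz yz).
apply: psiD_indep => //; first exact: MD.
move=> [t yzt]; have /eqP : ip (y + z) z = 0 by rewrite yzt dotZl xz mulr0.
by rewrite dotDl yz add0r dnorm_eq0 (negPf z0).
Qed.

Lemma psi_scale a x : M x -> exists b, psi (a *: x) = b *: psi x.
Proof.
move=> Mx; have [[c ->] _] := psiP (MZ a Mx).
have [d ->] := phi_scale a x; have [f ->] := phi_psi Mx.
by eexists; rewrite !scalerA.
Qed.

(** Scaling [x + y] by [a] multiplies [psi x + psi y] by a single scalar [t], so the factors of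
    [psi x] and [psi y] agree. *)
Lemma psi_scale_orth a b x y : M x -> M y -> ip x y = 0 -> x != 0 ->
  psi (a *: x) = b *: psi x -> psi (a *: y) = b *: psi y.
Proof.
move=> Mx My xy x0 ax; have [->|y0] := eqVneq y 0.
  by rewrite scaler0 psi_at0 scaler0.
have [b' ay] := psi_scale a My; have [t axy] := psi_scale a (MD Mx My).
have MaX := MZ a Mx; have MaY := MZ a My.
rewrite scalerDr !psiD// ax ay scalerDr in axy.
have pxy := psi_dot0 Mx My xy.
have pxx := psi_neq0 Mx x0; have pyy := psi_neq0 My y0.
have tb : b = t.
  have := congr1 (fun v => ip v (psi x)) axy.
  rewrite !dotDl !dotZl (dot0C pxy) !mulr0 !addr0; apply: mulIf.
  by rewrite dnorm_eq0.
by rewrite ay; move: axy; rewrite -tb => /addrI.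
Qed.

(** * The field morphism and the semilinear extension *)

Variable x0 : H.
Hypothesis Mx0 : M x0.
Hypothesis x01 : ip x0 x0 = 1.

Let x0_neq0 : x0 != 0.
Proof. by apply/eqP => e; move/eqP: x01; rewrite e linear0l eq_sym oner_eq0. Qed.

(** The scalars are read off at [x0] and carried to [x] through a vector orthogonal to both. *)
Lemma psi_semilinear_exists : exists s : C -> C,
  forall a x, M x -> psi (a *: x) = s a *: psi x.
Proof.
have /choice[s sP] : forall a, exists b, psi (a *: x0) = b *: psi x0.
  by move=> a; apply: psi_scale.
exists s => a x Mx; have [z [z0 Mz zx0 zx]] := infinite_orth3 e0 x0 x.
apply: (psi_scale_orth (x := z)) => //.
by apply: (psi_scale_orth (x := x0)) => //; apply: dot0C.
Qed.

Variable s : C -> C.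
Hypothesis psiZ : forall a x, M x -> psi (a *: x) = s a *: psi x.

(** Identities between scalars are tested on the nonzero vector [psi x0]. *)
Let psi_x0I a b : a *: psi x0 = b *: psi x0 -> a = b.
Proof.
move=> /eqP; rewrite -subr_eq0 -scalerBl scaler_eq0 subr_eq0.
by rewrite (negPf (psi_neq0 Mx0 x0_neq0)) orbF => /eqP.
Qed.

Lemma psi_scalarD : {morph s : a b / a + b}.
Proof.
move=> a b; apply: psi_x0I.
by rewrite scalerDl -!psiZ// scalerDl psiD//; apply: MZ.
Qed.

Lemma psi_scalar_zmod : zmod_morphism s.
Proof.
by move=> a b; apply/eqP; rewrite eq_sym subr_eq -psi_scalarD subrK.
Qed.

Lemma psi_scalar0 : s 0 = 0.
Proof. by have := psi_scalar_zmod 0 0; rewrite !subrr. Qed.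

Lemma psi_scalar_monoid : monoid_morphism s.
Proof.
split=> [|a b]; apply: psi_x0I; first by rewrite -psiZ// !scale1r.
by rewrite -!scalerA -!psiZ ?scalerA//; apply: MZ.
Qed.

(* [e0 + a *: x] and [e0 - b *: x] are orthogonal. *)
Lemma psi_dot_dual a b x : M x -> ip x x = 1 -> a * b^* = 1 ->
  s a * (s b)^* * ip (psi x) (psi x) = 1.
Proof.
move=> Mx x1 ab; have Ma := MZ a Mx; have Mb := MZ (- b) Mx.
have [d [d0 pa]] := psi_e0 Ma; have [d' [d'0 pb]] := psi_e0 Mb.
have /phi_dot0 : ip (e0 + a *: x) (e0 + (- b) *: x) = 0.
  rewrite !dotDl !dotDr !dotZl !dotZr (dot0C Mx) Mx e01 x1 !mulr0 addr0 add0r mulr1.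
  by rewrite rmorphN mulrN ab subrr.
rewrite pa pb dotZl dotZr => /eqP; rewrite !mulf_eq0 conjC_eq0 (negPf d0) (negPf d'0) /=.
have sN : s (- b) = - s b.
  by rewrite -[- b]sub0r psi_scalar_zmod psi_scalar0 sub0r.
rewrite !psiZ// sN !dotDl !dotDr !dotZl !dotZr u1 (dot_psi_u Mx) (dot0C (dot_psi_u Mx)).
rewrite !mulr0 addr0 add0r rmorphN mulNr mulrN subr_eq0 eq_sym => /eqP.
by rewrite mulrA.
Qed.

Lemma psi_unit x : M x -> ip x x = 1 -> ip (psi x) (psi x) = 1.
Proof.
move=> Mx x1; have := psi_dot_dual (a := 1) (b := 1) Mx x1.
by rewrite conjC1 mulr1 psi_scalar_monoid conjC1 !mul1r; apply.
Qed.

(** The duality relation for [a^*] and [a^-1], whose product after conjugating the second is 1. *)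
Lemma psi_scalar_conj a : s a^* = (s a)^*.
Proof.
have [->|a0] := eqVneq a 0; first by rewrite conjC0 psi_scalar0 conjC0.
have := psi_dot_dual (a := a^*) (b := a^-1) Mx0 x01.
rewrite psi_unit// mulr1 -rmorphM mulfV// rmorph1 => /(_ erefl).
have sV : s a^-1 = (s a)^-1.
  have sa : s a * s a^-1 = 1 by rewrite -psi_scalar_monoid mulfV// psi_scalar_monoid.
  have sa0 : s a != 0.
    by apply/eqP => sa0; move/eqP: sa; rewrite sa0 mul0r eq_sym oner_eq0.
  by apply: (mulfI sa0); rewrite sa mulfV.
by rewrite sV fmorphV; apply: divr1_eq.
Qed.

Lemma psi_norm x : M x -> ip (psi x) (psi x) = s (ip x x).
Proof.
move=> Mx; have [->|xn0] := eqVneq x 0.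
  by rewrite psi_at0 !linear0l psi_scalar0.
pose t := sqrtC (ip x x); have t0 : t != 0 by rewrite sqrtC_eq0 dnorm_eq0.
have tt : t * t^* = ip x x by rewrite -normCK ger0_norm ?sqrtC_ge0// sqrtCK.
have x1 : ip (t^-1 *: x) (t^-1 *: x) = 1 := dot_normalize ip xn0.
have Mtx := MZ t^-1 Mx; have := psi_unit Mtx x1.
have xE : x = t *: (t^-1 *: x) by rewrite scalerA mulfV// scale1r.
have -> : psi x = s t *: psi (t^-1 *: x) by rewrite -psiZ// -xE.
rewrite dotZl dotZr => ->.
by rewrite mulr1 -psi_scalar_conj -psi_scalar_monoid tt.
Qed.

(** The semilinear map that sends [e0] to [u] and agrees with [psi] on the orthogonal complement of
    [e0]. *)
Definition psi_ext v := s (ip v e0) *: u + psi (v - ip v e0 *: e0).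

Let M_proj v : M (v - ip v e0 *: e0).
Proof. by rewrite /M dotBl dotZl e01 mulr1 subrr. Qed.

Lemma psi_extD : {morph psi_ext : v w / v + w}.
Proof.
move=> v w; rewrite /psi_ext dotDl psi_scalarD !scalerDl opprD [v + w + _]addrACA.
by rewrite (psiD (M_proj v) (M_proj w)) addrACA.
Qed.

Lemma psi_extZ a v : psi_ext (a *: v) = s a *: psi_ext v.
Proof.
rewrite /psi_ext dotZl psi_scalar_monoid -!scalerA -scalerBr psiZ//.
by rewrite -scalerDr.
Qed.

Lemma psi_ext_norm v : ip (psi_ext v) (psi_ext v) = s (ip v v).
Proof.
set x := v - ip v e0 *: e0; have Mx : M x := M_proj v.
have vE : v = ip v e0 *: e0 + x by rewrite addrC subrK.
rewrite {1 2}/psi_ext -/x dot_normDd; last first.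
  by rewrite dotZl (dot0C (dot_psi_u Mx)) mulr0.
rewrite [in RHS]vE [in RHS]dot_normDd; last by rewrite dotZl (dot0C Mx) mulr0.
rewrite psi_scalarD psi_norm// !dotZl !dotZr u1 e01 !mulr1.
by rewrite psi_scalar_monoid psi_scalar_conj.
Qed.

(** If [t = ip v e0] is nonzero, rescaling [v] by [t^-1] brings it into the chart, where [u + psi]
    spans the image line; otherwise [v] is in the domain of [psi]. *)
Lemma psi_ext_phi v : exists c, psi_ext v = c *: phi v.
Proof.
rewrite /psi_ext; have := M_proj v.
have [t0 Mv|t0 Mx] := eqVneq (ip v e0) 0.
  rewrite t0 psi_scalar0 !scale0r add0r subr0; have [] := psiP t0.
  by move=> [c ->] _; exists c.
move: t0 Mx; set t := ip v e0; set x := v - _ => t0 Mx.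
have vE : v = t *: (e0 + t^-1 *: x).
  by rewrite scalerDr scalerA mulfV// scale1r addrC subrK.
have ss : s t * s t^-1 = 1.
  by rewrite -psi_scalar_monoid mulfV// psi_scalar_monoid.
have [d [d0 pd]] := psi_e0 (MZ t^-1 Mx).
have [c pc] := phi_scale t^-1 v.
rewrite {1}vE scalerA mulVf// scale1r pd psiZ// in pc.
exists (s t * (d^-1 * c)).
by rewrite -!scalerA -pc scalerK// scalerDr scalerA ss scale1r.
Qed.
Lemma psi_ext_isometry : exists (s : {rmorphism C -> C}) (L : H -> H),
    [/\ forall a, s a^* = (s a)^*,
        forall a x y, L (a *: x + y) = s a *: L x + L y,
        forall x, ip (L x) (L x) = s (ip x x)
      & forall x, exists c, L x = c *: phi x].
Proof.
pose sR : {rmorphism C -> C} := HB.pack s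
  (GRing.isZmodMorphism.Build C C s psi_scalar_zmod)
  (GRing.isMonoidMorphism.Build C C s psi_scalar_monoid).
exists sR, psi_ext; split=> [||x|] /=.
- exact: psi_scalar_conj.
- by move=> a x y; rewrite psi_extD psi_extZ.
- exact: psi_ext_norm.
- exact: psi_ext_phi.
Qed.

End OrthogonalLineation.

(** Over a general [C] the morphism is only shown to commute with conjugation, so square norms are
    preserved up to [s]. *)
Theorem orthogonal_lineation_isometry (C : numClosedFieldType) (H : lmodType C)
    (ip : {dot H for conjC}) (phi : H -> H) :
  infinite_dimensional H -> phi 0 = 0 -> (forall x, x != 0 -> phi x != 0) ->
  (forall x y, x != 0 -> y != 0 -> ip x y = 0 -> ip (phi x) (phi y) = 0) ->
  (forall x y a b, x != 0 -> y != 0 -> ip x y = 0 ->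
    a *: x + b *: y != 0 ->
    exists c d, phi (a *: x + b *: y) = c *: phi x + d *: phi y) ->
  (forall x y c, x != 0 -> y != 0 -> phi y = c *: phi x ->
    exists d, y = d *: x) ->
  exists (s : {rmorphism C -> C}) (L : H -> H),
    [/\ forall a, s a^* = (s a)^*,
        forall a x y, L (a *: x + y) = s a *: L x + L y,
        forall x, ip (L x) (L x) = s (ip x x)
      & forall x, exists c, L x = c *: phi x].
Proof.
move=> iH phi0 phi_n0 phi_o phi_l phi_i.
have [v [v0 _]] := infinite_orth ip [::] iH.
pose e0 := (sqrtC (ip v v))^-1 *: v.
have e01 : ip e0 e0 = 1 := dot_normalize ip v0.
have e0_neq0 : e0 != 0 by rewrite scaler_eq0 invr_eq0 sqrtC_eq0 dnorm_eq0 orbb.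
have pe0 := phi_n0 _ e0_neq0.
pose c0 := sqrtC (ip (phi e0) (phi e0)); pose u := c0^-1 *: phi e0.
have u1 : ip u u = 1 := dot_normalize ip pe0.
have phi_u : phi e0 = c0 *: u.
  by rewrite scalerA mulfV ?scale1r// sqrtC_eq0 dnorm_eq0.
have [w [w0 we0 _ _]] := infinite_orth3 ip iH e0 e0 e0.
pose x0 := (sqrtC (ip w w))^-1 *: w.
have x01 : ip x0 x0 = 1 := dot_normalize ip w0.
have Mx0 : ip x0 e0 = 0 by rewrite dotZl we0 mulr0.
(* Off the orthogonal complement of [e0] the value is the default 0; [psi_ext] evaluates [psi] only
   on that complement. *)
have /choice[psi psiP] : forall x, exists y, ip x e0 = 0 ->
    (exists c, y = c *: phi x) /\ (exists d, phi (e0 + x) = d *: (u + y)).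
  move=> x; have [/eqP xe|/eqP xe] := boolP (ip x e0 == 0); last by exists 0.
  by have [y yP] := psi_exists iH phi0 phi_n0 phi_o phi_l phi_i e01 phi_u xe; exists y.
have [s sP] := psi_semilinear_exists iH phi0 phi_n0 phi_o phi_l phi_i e01 phi_u u1 psiP Mx0 x01.
exact: (psi_ext_isometry iH phi0 phi_n0 phi_o phi_l phi_i e01 phi_u u1 psiP Mx0 x01 sP).
Qed.

(** * Maps of Grassmannians *)

Section Hilbert.
Variables (R : realType) (H : normedModType R[i]) (ip : {dot H for conjC}).
Hypothesis ip_norm : norm_induced_by ip.

(** Were [ip x v] nonzero, a point of the set closer to [x] than the radius [r0] would contradict
    Cauchy-Schwarz. *)
Lemma closed_orth v : closed [set x | ip x v = 0].
Proof.
move=> x clx /=; apply: contrapT => /eqP xv0.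
have v0 : v != 0 by apply: contraNneq xv0 => ->; rewrite linear0r.
have r0 : 0 < `|ip x v| / `|v| by rewrite divr_gt0 ?normr_gt0.
have [y [/= yv]] := clx _ (nbhsx_ballx x _ r0).
rewrite -ball_normE /= ltr_pdivlMr ?normr_gt0// => /lt_geF/negP; apply.
have -> : ip x v = ip (x - y) v by rewrite dotBl yv subr0.
rewrite -(ler_pXn2r (n := 2)) ?nnegrE ?mulr_ge0//.
by rewrite exprMn !ip_norm cauchy_schwarz.
Qed.

Lemma closed_span_linear (B : set H) : linear_subspace (closed_span B).
Proof.
apply/linear_subspaceP; split=> [S [[/subspace0 //] ]|a x y Bx By S SB].
have [[lS _] _] := SB; apply: subspaceD (By S SB) => //.
exact: subspaceZ (Bx S SB).
Qed.

End Hilbert.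

(** * From the hypothesis on [f] to the isometry *)

Section Induced.
Variables (R : realType) (H : normedModType R[i]) (ip : {dot H for conjC}).
Variables (n : nat) (f : grassmannian H n.+1 -> grassmannian H n.+1).
Hypothesis ip_norm : norm_induced_by ip.
Hypothesis f_inj : injective f.
Let H' := closed_span (\bigcup_(X : grassmannian H n.+1) val (f X)).
Hypothesis fP : forall X Y : grassmannian H n.+1, subspace_ortho ip (val X) (val Y) ->
    exists (J : Type) (Z : J -> grassmannian H n.+1),
      [/\ mutually_ortho ip (fun j => val (Z j)),
          forall j, subspace_ortho ip (val (Z j)) (sum_subspace (val X) (val Y))
        & orthogonal_sum ip
            (add_two (val (f X)) (val (f Y)) (fun j => val (f (Z j)))) H'].

Lemma grassmannian_po (X : grassmannian H n.+1) : exists s : seq H,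
  [/\ pairwise_orthogonal ip s, size s = n.+1 & val X = lspan s].
Proof. by have [_ /(has_dim_po ip)[s sP]] := set_valP X; exists s. Qed.

Lemma po_grassmannian s : pairwise_orthogonal ip s -> size s = n.+1 ->
  exists X : grassmannian H n.+1, val X = lspan s.
Proof.
move=> os ss; have Gs : grassmannian H n.+1 (lspan s).
  by split; [exact: linear_lspan|rewrite -ss; exact: (po_has_dim os)].
by exists (SigSub (mem_set Gs)).
Qed.

Lemma f_ortho X Y : subspace_ortho ip (val X) (val Y) ->
  subspace_ortho ip (val (f X)) (val (f Y)).
Proof.
move=> /fP[J [Z [_ _ [_ mo _]]]].
exact: (mo (inl true) (inl false)).
Qed.

(** The residual [v - p] of the projection onto [f X + f Y] lies in [H'] and is orthogonal to every
    summand of [H'], hence to itself. *)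
Lemma f_sub_sum X Y W : subspace_ortho ip (val X) (val Y) ->
  val W `<=` sum_subspace (val X) (val Y) ->
  val (f W) `<=` sum_subspace (val (f X)) (val (f Y)).
Proof.
move=> XY WXY v Wv; have oXY := f_ortho XY.
have [s [os ss fXs]] := grassmannian_po (f X).
have [t [ot st fYt]] := grassmannian_po (f Y).
have ost : pairwise_orthogonal ip (s ++ t).
  rewrite po_cat os ot; apply/orthP => x y sx ty.
  by apply: oXY; rewrite ?fXs ?fYt; apply: mem_lspan.
have [J [Z [_ ZXY [_ mo H'E]]]] := fP XY.
rewrite fXs fYt -lspan_cat; set p := orth_proj ip (s ++ t) v.
suff vp : v - p = 0 by move/subr0_eq: vp => ->; apply: orth_proj_lspan.
have H'f X' : val (f X') `<=` H'.
  by move=> x X'x S [_]; apply; exists X'.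
have lH' : linear_subspace H' by apply: closed_span_linear.
have H'p : H' p.
  apply: (lspan_sub lH') (orth_proj_lspan ip (s ++ t) v) => x.
  rewrite mem_cat => /orP[] /mem_lspan; first by rewrite -fXs; apply: H'f.
  by rewrite -fYt; apply: H'f.
apply: (@dot_self0 _ _ ip).
have : H' (v - p) by apply: subspaceB (H'p) => //; apply: (H'f W).
(* The vectors orthogonal to [v - p] form a closed subspace; once it contains the summands, it
   contains [H']. *)
rewrite H'E => /(_ [set x | ip x (v - p) = 0]); apply; split.
  by split; [exact: linear_orth|exact: closed_orth].
move=> x [[[]|j] _] /=.
- rewrite fXs => sx; apply: dot0C; apply: orth_proj_orth => //.
  by rewrite lspan_cat; exists x => //; exists 0; rewrite ?addr0//; apply: subspace0 (linear_lspan _).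
- rewrite fYt => tx; apply: dot0C; apply: orth_proj_orth => //.
  by rewrite lspan_cat; exists 0; rewrite ?add0r//; [apply: subspace0 (linear_lspan _)|exists x; rewrite ?add0r].
- move=> Zx.
  have xp : ip x p = 0.
    apply: orth_lspanr (orth_proj_lspan ip (s ++ t) v) => y.
    rewrite mem_cat => /orP[] /mem_lspan.
      rewrite -fXs; exact: (mo (inr j) (inl true)).
    rewrite -fYt; exact: (mo (inr j) (inl false)).
  have ZW : subspace_ortho ip (val (Z j)) (val W).
    by move=> a b Za /WXY ab; exact: (ZXY j a b Za ab).
  by rewrite dotBr xp (f_ortho ZW Zx Wv) subr0.
Qed.

(* Empty when [A] does not belong to [grassmannian H n.+1]. *)
Definition grass_map (A : set H) : set H :=
  [set v | exists X : grassmannian H n.+1, val X = A /\ val (f X) v].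

Lemma grass_mapE X : grass_map (val X) = val (f X).
Proof.
by apply/seteqP; split=> [v [Y [/val_inj -> //]]|v fXv]; exists X.
Qed.

Lemma grass_map_lspan s : pairwise_orthogonal ip s -> size s = n.+1 ->
  exists X : grassmannian H n.+1, val X = lspan s /\ grass_map (lspan s) = val (f X).
Proof.
move=> os /(po_grassmannian os)[X Xs]; exists X; split=> //.
by rewrite -Xs grass_mapE.
Qed.

Lemma grass_map_dim s : pairwise_orthogonal ip s -> size s = n.+1 ->
  exists t : seq H, [/\ pairwise_orthogonal ip t, size t = n.+1
    & grass_map (lspan s) = lspan t].
Proof.
move=> os /(grass_map_lspan os)[X [_ ->]]; have [t tP] := grassmannian_po (f X).
by exists t.
Qed.

Lemma grass_map_inj s t : pairwise_orthogonal ip s -> size s = n.+1 ->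
  pairwise_orthogonal ip t -> size t = n.+1 ->
  grass_map (lspan s) = grass_map (lspan t) -> lspan s = lspan t.
Proof.
move=> os /(grass_map_lspan os)[X [<- ->]] ot /(grass_map_lspan ot)[Y [<- ->]].
by move=> /val_inj/f_inj ->.
Qed.

Lemma grass_map_orth s t : pairwise_orthogonal ip (s ++ t) ->
  size s = n.+1 -> size t = n.+1 ->
  forall x y, grass_map (lspan s) x -> grass_map (lspan t) y -> ip x y = 0.
Proof.
rewrite po_cat => /and3P[os ot st].
move=> /(grass_map_lspan os)[X [Xs ->]] /(grass_map_lspan ot)[Y [Yt ->]].
by apply: f_ortho => x y; rewrite Xs Yt; apply: orth_lspan.
Qed.

Lemma grass_map_sum s t w : pairwise_orthogonal ip (s ++ t) ->
  pairwise_orthogonal ip w -> size s = n.+1 -> size t = n.+1 ->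
  size w = n.+1 -> lspan w `<=` lspan (s ++ t) ->
  grass_map (lspan w) `<=` sum_subspace (grass_map (lspan s)) (grass_map (lspan t)).
Proof.
rewrite po_cat lspan_cat => /and3P[os ot st] ow.
move=> /(grass_map_lspan os)[X [Xs ->]] /(grass_map_lspan ot)[Y [Yt ->]].
move=> /(grass_map_lspan ow)[W [Ww ->]]; rewrite -Xs -Yt -Ww.
by apply: f_sub_sum => x y; rewrite Xs Yt; apply: orth_lspan.
Qed.

(** [L x] spans the line of [phi x] for nonzero [x], and the images under [phi] of an orthogonal
    basis of [X] span [f X]. *)
Lemma grassmannian_map_isometry : infinite_dimensional H -> exists L : H -> H,
  [/\ linear L \/ conj_linear L, is_isometry L
    & forall X : grassmannian H n.+1, val (f X) = L @` val X].
Proof.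
move=> infH.
have [phi [phi0 phiP]] := exists_axis_map infH grass_map_dim grass_map_inj
  grass_map_orth grass_map_sum.
have phi_span := lspan_map_axis infH grass_map_dim grass_map_orth phiP.
have [||||s [L [s_conj Llin L_norm L_phi]]] :=
  orthogonal_lineation_isometry (ip := ip) infH phi0.
- exact: axis_map_neq0 phiP.
- by move=> x y; apply: (axis_map_orth infH grass_map_orth phiP).
- move=> x y a b; apply: (axis_map_line infH grass_map_dim grass_map_orth
    grass_map_sum phiP).
- move=> x y c; apply: (axis_map_inj infH grass_map_dim grass_map_inj
    grass_map_orth phiP).
have s_cases := conj_morph_id_or_conj s_conj.
(* As an involution [s] is onto, so [L] maps subspaces to subspaces and scalars can be pulled back
   through it. *)
have ssK : involutive s.
  by case: s_cases => sE a; rewrite !sE ?conjCK.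
have L0 : L 0 = 0.
  by apply: (@dot_self0 _ _ ip); rewrite L_norm linear0l rmorph0.
have LB x y : L (x - y) = L x - L y.
  by rewrite addrC -scaleN1r Llin rmorphN1 scaleN1r addrC.
(* [ip x x] is its own conjugate, so it is fixed in both cases. *)
have s_dot x : s (ip x x) = ip x x.
  by case: s_cases => ->; rewrite // -dotC.
exists L; split.
- by case: s_cases => sE; [left|right] => a x y; rewrite Llin sE.
- move=> x y; apply/eqP; rewrite -(eqrXn2 (n := 2))// !ip_norm.
  by rewrite -LB L_norm s_dot.
move=> X; have [t [ot st Xt]] := grassmannian_po X.
rewrite -grass_mapE Xt -phi_span//.
have lL : linear_subspace (L @` lspan t).
  have lt := linear_lspan t; apply/linear_subspaceP; split.
    by exists 0; [apply: subspace0|].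
  move=> a _ _ [x tx <-] [y ty <-]; exists (s a *: x + y).
    by apply: subspaceD => //; apply: subspaceZ.
  by rewrite Llin ssK.
apply/seteqP; split=> [|_ [x tx <-]].
  apply: (lspan_sub lL) => _ /mapP[x xt ->].
  have x0 := po_neq0 ot xt; have [c Lc] := L_phi x.
  have c0 : c != 0.
    apply: contraNneq x0 => c0; have := L_norm x.
    by rewrite Lc c0 scale0r linear0l s_dot => /esym/dot_self0 ->.
  (* Semilinearity turns this scalar into [s (s c^-1) = c^-1], which cancels the [c] of
     [L x = c *: phi x]. *)
  exists (s c^-1 *: x).
    by apply: subspaceZ (linear_lspan t) _; apply: mem_lspan.
  by rewrite -[_ *: x]addr0 Llin ssK L0 addr0 Lc scalerK.
have lP := linear_lspan (map phi t).
suff : lspan t `<=` [set x | lspan (map phi t) (L x)] by apply.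
apply: lspan_sub => [|y yt /=].
  apply/linear_subspaceP; split=> /= [|a y z yP zP]; first by rewrite L0; apply: subspace0.
  by rewrite Llin; apply: subspaceD => //; apply: subspaceZ.
have [c ->] := L_phi y; apply: subspaceZ => //; apply: mem_lspan; exact: map_f.
Qed.

End Induced.

Theorem corollary1 (R : realType) (H : completeNormedModType R[i])
    (ip : {dot H for conjC}) (k : nat)
    (f : grassmannian H k -> grassmannian H k) :
  norm_induced_by ip -> infinite_dimensional H -> (0 < k)%N ->
  injective f ->
  let H' : set H := closed_span (\bigcup_(X : grassmannian H k) val (f X)) in
  (forall X Y : grassmannian H k, subspace_ortho ip (val X) (val Y) ->
    exists (J : Type) (Z : J -> grassmannian H k),
      [/\ mutually_ortho ip (fun j => val (Z j)),
          forall j, subspace_ortho ip (val (Z j)) (sum_subspace (val X) (val Y))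
        & orthogonal_sum ip
            (add_two (val (f X)) (val (f Y)) (fun j => val (f (Z j)))) H']) ->
  exists L : H -> H,
    [/\ linear L \/ conj_linear L,
        is_isometry L
      & forall X : grassmannian H k, val (f X) = L @` val X].
Proof.
move=> ip_norm infH; case: k f => // n f _ f_inj H' fP.
exact: (grassmannian_map_isometry ip_norm f_inj fP infH).
Qed.
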